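(* Let $M$ be a Garside monoid with Garside element $\Delta$ and set of simple elements $S$, and suppose that $M$ has $m$ atoms. If $\mathcal{P}$ is a property for simple elements that is closed under gcd, then $\#(\min(S_{\mathcal{P}}))\leq m$.
   Context: In a cancellative monoid $M$ with no invertible elements other than $1$, write $a\prec b$ if $ac=b$ for some $c\in M$ ($a$ is a left divisor of $b$) and $b\succ a$ if $b=ca$ for some $c\in M$ ($a$ is a right divisor of $b$). An atom is an element $x\neq 1$ such that $x=yz$ implies $y=1$ or $z=1$. $M$ is atomic if it is generated by its atoms and for every $x\in M$ there is an integer $N_x>0$ such that $x$ is not a product of more than $N_x$ atoms. $M$ is Gaussian if it is atomic, left and right cancellative, and every pair of elements has a (left and right) lcm and a (left and right) gcd; $a\vee b$ and $a\wedge b$ denote the left lcm and left gcd, i.e. those with respect to $\prec$. A Garside element is an element $\Delta\in M$ whose left divisors coincide with its right divisors, form a finite set, and generate $M$; a Garside monoid is a Gaussian monoid having a Garside element $\Delta$ (fixed). The divisors of $\Delta$ are the simple elements, and $S$ is the finite set of them. For a property $\mathcal{P}$ of simple elements, $S_{\mathcal{P}}\subset S$ is the set of simple elements satisfying $\mathcal{P}$, and $\min(S_{\mathcal{P}})$ is the set of $\prec$-minimal elements among the nontrivial ($\neq 1$) elements of $S_{\mathcal{P}}$. $\mathcal{P}$ is closed under gcd if $s_1,s_2\in S_{\mathcal{P}}$ implies $s_1\wedge s_2\in S_{\mathcal{P}}$. *)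

(* Defs.v *)
From HB Require Import structures.
From mathcomp Require Import all_boot.
From mathcomp Require Import boolp classical_sets functions cardinality.

Set Implicit Arguments.
Unset Strict Implicit.
Unset Printing Implicit Defensive.

Import Algebra.

Local Open Scope classical_set_scope.
Local Open Scope card_scope.
Local Open Scope group_scope.

Section Divisibility.
Variable M : monoidType.
Implicit Types (a b c d x : M) (A : set M).

(* [ldvd a b] is the relation "a is a left divisor of b" (a \prec b), and
   [rdvd a b] is "a is a right divisor of b" (b \succ a); in both cases the
   divisor is the first argument. *)
Definition ldvd a b : Prop := exists c, a * c = b.
Definition rdvd a b : Prop := exists c, b = c * a.

Definition is_llcm a b c : Prop :=
  [/\ ldvd a c, ldvd b c & forall d, ldvd a d -> ldvd b d -> ldvd c d].
Definition is_rlcm a b c : Prop :=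
  [/\ rdvd a c, rdvd b c & forall d, rdvd a d -> rdvd b d -> rdvd c d].
Definition is_lgcd a b c : Prop :=
  [/\ ldvd c a, ldvd c b & forall d, ldvd d a -> ldvd d b -> ldvd d c].
Definition is_rgcd a b c : Prop :=
  [/\ rdvd c a, rdvd c b & forall d, rdvd d a -> rdvd d b -> rdvd d c].

(* The left gcd (a \wedge b); the default value 1 is never used in a Gaussian
   monoid, where left gcds exist and are unique: see [lgcdP], [lgcd_unique]. *)
Definition lgcd a b : M := xget 1 [set c | is_lgcd a b c].

Definition atom : set M :=
  [set x | x <> 1 /\ forall y z, x = y * z -> y = 1 \/ z = 1].

Definition generates A : Prop :=
  forall x, exists2 s : seq M,
    (forall y, y \in s -> A y) & x = \prod_(y <- s) y.

Definition cancellative : Prop :=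
  right_injective (@mul M) /\ left_injective (@mul M).

Definition no_invertible : Prop :=
  forall a b, a * b = 1 -> b * a = 1 -> a = 1.

Record atomic : Prop := {
  atomic_gen : generates atom;
  atomic_bound : forall x, exists2 N : nat, (0 < N)%N &
    forall s : seq M, (forall y, y \in s -> atom y) ->
      x = \prod_(y <- s) y -> (size s <= N)%N
}.

Record gaussian : Prop := {
  gaussian_cancel : cancellative;
  gaussian_no_inv : no_invertible;
  gaussian_atomic : atomic;
  gaussian_llcm : forall a b, exists c, is_llcm a b c;
  gaussian_rlcm : forall a b, exists c, is_rlcm a b c;
  gaussian_lgcd : forall a b, exists c, is_lgcd a b c;
  gaussian_rgcd : forall a b, exists c, is_rgcd a b c
}.

Record garside_element (Delta : M) : Prop := {
  garside_ldvd_rdvd : [set a | ldvd a Delta] = [set a | rdvd a Delta];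
  garside_finite : finite_set [set a | ldvd a Delta];
  garside_gen : generates [set a | ldvd a Delta]
}.

Definition garside_monoid (Delta : M) : Prop :=
  gaussian /\ garside_element Delta.

Definition simple (Delta : M) : set M := [set s | ldvd s Delta].

(* A property of simple elements is given by a predicate P on M, of which only
   the restriction to the simple elements is ever used. *)
Definition simple_sat (Delta : M) (P : M -> Prop) : set M :=
  [set s | simple Delta s /\ P s].

Definition closed_under_gcd (Delta : M) (P : M -> Prop) : Prop :=
  forall s1 s2, simple_sat Delta P s1 -> simple_sat Delta P s2 ->
    simple_sat Delta P (lgcd s1 s2).

Definition ldvd_minimal A : set M :=
  [set s | [/\ A s, s <> 1 & forall t, A t -> t <> 1 -> ldvd t s -> t = s]].

Lemma lgcdP (gM : gaussian) a b : is_lgcd a b (lgcd a b).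
Proof. exact/(@xgetPex M 1 [set c | is_lgcd a b c])/gaussian_lgcd. Qed.

Lemma ldvd_anti (gM : gaussian) a b : ldvd a b -> ldvd b a -> a = b.
Proof.
have [[canl _] noinv _ _ _ _ _] := gM.
move=> [c eb] [d ea].
have cd1 : c * d = 1 by apply: (canl a); rewrite mulgA eb ea mulg1.
have dc1 : d * c = 1 by apply: (canl b); rewrite mulgA ea eb mulg1.
by rewrite -eb (noinv _ _ cd1 dc1) mulg1.
Qed.

Lemma lgcd_unique (gM : gaussian) a b c : is_lgcd a b c -> c = lgcd a b.
Proof.
move=> [ca cb cmax]; have [ga gb gmax] := lgcdP gM a b.
by apply: (ldvd_anti gM); [exact: gmax | exact: cmax].
Qed.

End Divisibility.

Arguments atom M : clear implicits.
Arguments atomic M : clear implicits.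
Arguments gaussian M : clear implicits.

(* Main.v *)
Require Import Defs.
From HB Require Import structures.
From mathcomp Require Import all_boot.
From mathcomp Require Import boolp classical_sets functions cardinality.

Local Open Scope classical_set_scope.
Local Open Scope card_scope.

(** Each minimal element of [simple_sat Delta P] is nontrivial, so it has an atom as a
    left divisor ([atom_ldvd]).  No atom can left-divide two distinct minimal
    elements: it would left-divide their gcd, which would then be a nontrivial
    member of [simple_sat Delta P] below both of them, so that minimality forces the gcd
    to equal each of the two ([ldvd_minimal_common_atom]).  Choosing an atom
    below each minimal element is thus injective, and there are at most as many
    minimal elements as atoms. *)

(** A one-sided inverse is two-sided by cancellation, so it must be trivial. *)
Lemma ldvd1 (M : monoidType) (gM : gaussian M) (a : M) :
  ldvd a 1%g -> a = 1%g.
Proof.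
have [[canl _] noinv _ _ _ _ _] := gM.
move=> [c ac1]; apply: (noinv a c) => //.
by apply: (canl a); rewrite mulgA ac1 mul1g mulg1.
Qed.

(** The first letter of any decomposition into atoms is a left divisor. *)
Lemma atom_ldvd (M : monoidType) (gM : gaussian M) (x : M) :
  x <> 1%g -> exists2 a, atom M a & ldvd a x.
Proof.
move=> x1; have [[|a s] sA xE] := atomic_gen (gaussian_atomic gM) x.
  by case: x1; rewrite xE big_nil.
exists a; first by apply: sA; rewrite mem_head.
by exists (\prod_(y <- s) y)%g; rewrite xE big_cons.
Qed.

(** The common divisor [a] makes the gcd of [s] and [t] nontrivial; the gcd
    then lies in [A] below both, and minimality identifies it with each. *)
Lemma ldvd_minimal_common_atom (M : monoidType) (gM : gaussian M)
    (A : set M) (a s t : M) :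
  (forall x y, A x -> A y -> A (lgcd x y)) ->
  atom M a -> ldvd_minimal A s -> ldvd_minimal A t ->
  ldvd a s -> ldvd a t -> s = t.
Proof.
move=> Agcd [a1 _] [As _ smin] [At _ tmin] a_s a_t.
have [gs gt gmax] := lgcdP gM s t.
have g1 : lgcd s t <> 1%g.
  by move=> g1; apply/a1/(ldvd1 _ gM); rewrite -g1; exact: gmax.
have Ag := Agcd _ _ As At.
by rewrite -(smin _ Ag g1 gs); exact: tmin.
Qed.

Theorem corollary4p3 (M : monoidType) (Delta : M) (m : nat) (P : M -> Prop)
    (hM : garside_monoid Delta)
    (hm : atom M #= `I_m)
    (hP : closed_under_gcd Delta P) :
  ldvd_minimal (simple_sat Delta P) #<= `I_m.
Proof.
have [gM _] := hM.
have /choice [f fP] (s : M) : exists a, s <> 1%g -> atom M a /\ ldvd a s.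
  have [->|/(atom_ldvd _ gM) [a aA a_s]] := EM (s = 1%g); first by exists 1%g.
  by exists a.
have f_inj : {in ldvd_minimal (simple_sat Delta P) &, injective f}.
  move=> s t /set_mem sA /set_mem tA fst.
  have [_ s1 _] := sA; have [_ t1 _] := tA.
  have [a_atom a_s] := fP s s1; have [_ a_t] := fP t t1.
  rewrite -fst in a_t.
  exact: (ldvd_minimal_common_atom _ gM _ _ _ _ hP a_atom sA tA a_s a_t).
rewrite -(card_le_eqr hm) -(card_le_eql (inj_card_eq f_inj)).
apply: subset_card_le => _ [s [_ s1 _] <-].
by have [] := fP s s1.
Qed.
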